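(* Let $G$ be a finite, simple, connected graph with vertex set $V$ and maximum degree $m$, and let $\sigma:V\to V$ be an involution of $G$. Let $v\in V$ with $v':=\sigma(v)\neq v$, and let $d=d(v,v')$ be the graph distance between $v$ and $v'$. For a real number $Q$, let $H=A_G+D_Q$ where the potential is $Q$ at $v$ and at $v'$ and $0$ at every other vertex. Then for every $Q\ge m$, $$F(Q)>1-\frac{16\sqrt{m+1}}{\sqrt{Q}},$$ and moreover this lower bound is attained by $p(t)$ at some time $t\ge 0$ with $t=O\big(Q^{d-1}\big)$ as $Q\to\infty$.
   Context: $A_G$ is the adjacency matrix of $G$ and $D_Q$ is the diagonal matrix whose diagonal entries are the potential values at the vertices. An involution of $G$ is a bijection $\sigma:V\to V$ with $\sigma\circ\sigma=\mathrm{id}$ such that $x\sim y$ implies $\sigma(x)\sim\sigma(y)$ (and which preserves the potential; here the potential is $Q$ on $\{v,v'\}$ and $0$ elsewhere, so this holds automatically). The transfer probability from $v$ to $v'$ at time $t$ is $p(t)=|\langle e_v, e^{itH} e_{v'}\rangle|^2$, where $e_x$ is the standard basis vector of vertex $x$, and the fidelity is $F(Q)=\sup_{t\ge 0}p(t)$. *)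

(* Defs.v *)
From HB Require Import structures.
From mathcomp Require Import all_boot all_order all_algebra.
From mathcomp Require Import all_classical all_reals all_analysis.
Set Implicit Arguments. Unset Strict Implicit. Unset Printing Implicit Defensive.
Import Order.TTheory GRing.Theory Num.Theory numFieldNormedType.Exports.
Local Open Scope ring_scope.

Definition simple_graph n (e : rel 'I_n) :=
  (forall x y, e x y = e y x) /\ (forall x, ~~ e x x).

Definition walk n (e : rel 'I_n) (x y : 'I_n) (k : nat) :=
  exists p : seq 'I_n, size p = k /\ path e x p /\ last x p = y.

Definition connected_graph n (e : rel 'I_n) := forall x y, exists k, walk e x y k.

Definition is_dist n (e : rel 'I_n) (x y : 'I_n) (d : nat) :=
  walk e x y d /\ forall k, walk e x y k -> (d <= k)%N.

Definition maxdeg n (e : rel 'I_n) : nat := \max_(x : 'I_n) #|[set y | e x y]|.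

Definition graph_involution n (e : rel 'I_n) (s : 'I_n -> 'I_n) :=
  (forall x, s (s x) = x) /\ (forall x y, e x y -> e (s x) (s y)).

Definition adjmx (R : pzRingType) n (e : rel 'I_n) : 'M[R]_n :=
  \matrix_(i, j) (e i j)%:R.

Definition potmx (R : pzRingType) n (Q : R) (v v' : 'I_n) : 'M[R]_n :=
  \matrix_(i, j) (if (i == j) && ((i == v) || (i == v')) then Q else 0).

Definition hamil (R : pzRingType) n (e : rel 'I_n) (Q : R) (v v' : 'I_n) : 'M[R]_n :=
  adjmx R e + potmx Q v v'.

(* For real symmetric H, <e_v, e^{itH} e_v'> = (cos tH)_{vv'} + i (sin tH)_{vv'};
   these are given by their power series. *)
Definition cos_entry (R : realType) n (H : 'M[R]_n) (t : R) (x y : 'I_n) : R :=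
  limn (series (fun k : nat => (-1) ^+ k * t ^+ (2 * k) / ((2 * k)`!)%:R * (H ^+ (2 * k)) x y)).

Definition sin_entry (R : realType) n (H : 'M[R]_n) (t : R) (x y : 'I_n) : R :=
  limn (series (fun k : nat => (-1) ^+ k * t ^+ (2 * k).+1 / ((2 * k).+1`!)%:R * (H ^+ (2 * k).+1) x y)).

(* transfer probability p(t) = |<e_v, e^{itH} e_v'>|^2 *)
Definition transfer_prob (R : realType) n (H : 'M[R]_n) (v v' : 'I_n) (t : R) : R :=
  cos_entry H t v v' ^+ 2 + sin_entry H t v v' ^+ 2.

Definition fidelity (R : realType) n (H : 'M[R]_n) (v v' : 'I_n) : R :=
  sup [set transfer_prob H v v' t | t in [set t : R | 0 <= t]]%classic.

(* Main.v *)
Require Import Defs.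
From HB Require Import structures.
From mathcomp Require Import all_boot all_order all_algebra.
From mathcomp Require Import all_classical all_reals all_analysis.
From mathcomp Require Import spectral sesquilinear ring lra.
From mathcomp.real_closed Require complex.
Set Implicit Arguments. Unset Strict Implicit. Unset Printing Implicit Defensive.
Import Order.TTheory GRing.Theory Num.Theory numFieldNormedType.Exports.
Local Open Scope ring_scope.

(* When [Q < 256 (m + 1)] the bound is negative, so let [Q] be larger.  Testing
   [H] against [e_v + e_v'] and [e_v - e_v'] and symmetrizing under the
   involution yields an even eigenvector [phi] (eigenvalue [k]) and an odd one
   [psi] (eigenvalue [l]) with value [1] at [v] and [k, l > Q - 2].  Away from
   [v] and [v'] the equation [A phi = k phi] with [k] much larger than [m] makes
   them small, so that they carry all but a fraction [m / (Q - 2)] of [e_v] and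
   [e_v'].  At time [t = pi / (k - l)] the two modes have opposite phases and
   add up in the amplitude from [v] to [v'], while the rest of the spectrum
   contributes at most its mass, whence [p(t) >= 1 - 4 m / (Q - 2)].  Finally a
   maximum principle for [phi - psi] along a shortest path from [v] to [v']
   shows [k - l >= ((k + l) / 2) ^ (1 - d)], so [t = O(Q ^ (d - 1))]. *)

Definition dot (R : pzSemiRingType) n (u w : 'rV[R]_n) : R := (u *m w^T) 0 0.

Section Dot.
Variables (R : comNzRingType) (n : nat).
Implicit Types (u w : 'rV[R]_n).

Lemma dotE u w : dot u w = \sum_x u 0 x * w 0 x.
Proof. by rewrite /dot mxE; apply: eq_bigr => x _; rewrite mxE. Qed.

Lemma dotC u w : dot u w = dot w u.
Proof. by rewrite !dotE; apply: eq_bigr => x _; rewrite mulrC. Qed.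

Lemma dotDl u u' w : dot (u + u') w = dot u w + dot u' w.
Proof. by rewrite /dot mulmxDl mxE. Qed.

Lemma dotZl c u w : dot (c *: u) w = c * dot u w.
Proof. by rewrite /dot -scalemxAl mxE. Qed.

Lemma dotBl u u' w : dot (u - u') w = dot u w - dot u' w.
Proof. by rewrite /dot mulmxBl !mxE. Qed.

Lemma dotDr u w w' : dot u (w + w') = dot u w + dot u w'.
Proof. by rewrite dotC dotDl !(dotC u). Qed.

Lemma dotZr c u w : dot u (c *: w) = c * dot u w.
Proof. by rewrite dotC dotZl dotC. Qed.

Lemma dotBr u w w' : dot u (w - w') = dot u w - dot u w'.
Proof. by rewrite dotC dotBl !(dotC u). Qed.

Lemma dot_mulmx m (M : 'M[R]_(m, n)) (u : 'rV_m) w :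
  dot (u *m M) w = dot u (w *m M^T).
Proof. by rewrite /dot trmx_mul trmxK mulmxA. Qed.

Lemma dot_row m (M : 'M[R]_(m, n)) u j : dot u (row j M) = (u *m M^T) 0 j.
Proof. by rewrite dotE mxE; apply: eq_bigr => x _; rewrite !mxE. Qed.

Lemma dot_delta u x : dot u (delta_mx 0 x) = u 0 x.
Proof. by rewrite /dot trmx_delta -colE mxE. Qed.

Lemma dot_delta_mulmx (M : 'M[R]_n) x y :
  dot (delta_mx 0 x *m M) (delta_mx 0 y) = M x y.
Proof. by rewrite dot_delta -rowE mxE. Qed.

End Dot.

Section Residual.
Variables (R : fieldType) (n : nat).
Implicit Types (phi u w : 'rV[R]_n) (K : 'M[R]_n).

Definition residual phi u := u - (dot u phi / dot phi phi) *: phi.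

Lemma dot_residual phi psi u : dot phi psi = 0 ->
  dot (residual phi u) psi = dot u psi.
Proof. by move=> ort; rewrite dotBl dotZl ort mulr0 subr0. Qed.

Lemma dot_residual_mulmx K phi l u w : K^T = K -> phi *m K = l *: phi ->
  dot (residual phi u *m K) (residual phi w) =
  dot (u *m K) w - l * (dot u phi * dot w phi / dot phi phi).
Proof.
move=> symK phiK; set N := dot phi phi.
have [N_eq0|N_neq0] := eqVneq N 0.
  by rewrite /residual -/N N_eq0 invr0 !(mulr0, scale0r, subr0).
have dot_phi x : dot (x *m K) phi = l * dot x phi.
  by rewrite dot_mulmx symK phiK dotZr.
have dotK x y : dot (x *m K) y = dot (y *m K) x by rewrite dot_mulmx symK dotC.
have residualK y : dot (residual phi u *m K) y =
    dot (u *m K) y - dot u phi / N * (l * dot phi y).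
  by rewrite dotK dotBr dotZr dot_phi dotK (dotC y).
rewrite residualK !dotBr !dotZr dot_phi (dotC phi w) -/N.
by field.
Qed.

Lemma dot_residual_pair K phi psi k l u w :
  K^T = K -> phi *m K = k *: phi -> psi *m K = l *: psi -> dot phi psi = 0 ->
  dot (residual psi (residual phi u) *m K) (residual psi (residual phi w)) =
  dot (u *m K) w - k * (dot u phi * dot w phi / dot phi phi) -
    l * (dot u psi * dot w psi / dot psi psi).
Proof.
move=> symK phiK psiK ort.
rewrite (dot_residual_mulmx _ _ symK psiK) (dot_residual_mulmx _ _ symK phiK).
by rewrite !dot_residual.
Qed.

End Residual.

Lemma dot_eigenrow_eq0 (R : fieldType) n (H : 'M[R]_n) (phi psi : 'rV[R]_n)
    k l :
  H^T = H -> phi *m H = k *: phi -> psi *m H = l *: psi -> k != l ->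
  dot phi psi = 0.
Proof.
move=> symH phiH psiH kl; apply/eqP; move: kl; apply: contraR => dot_neq0.
by apply/eqP/(mulIf dot_neq0); rewrite -dotZl -phiH dot_mulmx symH psiH dotZr.
Qed.

Section Eigenframe.
Variables (R : realFieldType) (m n : nat).
Implicit Types (u w : 'rV[R]_n) (F G : R -> R).

(* The rows of [W] are eigenvectors of [H] forming a Parseval frame, a weak form
   of an orthonormal eigenbasis. *)
Definition eigenframe (H : 'M[R]_n) (W : 'M[R]_(m, n)) (mu : 'rV[R]_m) : Prop :=
  W *m H = diag_mx mu *m W /\ W^T *m W = 1%:M.

Definition spectral_calc (W : 'M[R]_(m, n)) (mu : 'rV[R]_m) F : 'M[R]_n :=
  W^T *m diag_mx (map_mx F mu) *m W.

Variables (H : 'M[R]_n) (W : 'M[R]_(m, n)) (mu : 'rV[R]_m).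
Local Notation calc := (spectral_calc W mu).

Lemma tr_spectral_calc F : (calc F)^T = calc F.
Proof. by rewrite /spectral_calc !trmx_mul trmxK tr_diag_mx mulmxA. Qed.

Lemma dot_spectral_calc F u w : dot (u *m calc F) w =
  \sum_j F (mu 0 j) * ((u *m W^T) 0 j * (w *m W^T) 0 j).
Proof.
rewrite /spectral_calc !mulmxA dot_mulmx dotE; apply: eq_bigr => j _.
by rewrite mul_mx_diag !mxE mulrCA mulrA.
Qed.

Lemma spectral_calcE F x y : calc F x y = \sum_j F (mu 0 j) * (W j x * W j y).
Proof.
rewrite -dot_delta_mulmx dot_spectral_calc.
by apply: eq_bigr => j _; rewrite -!rowE !mxE.
Qed.

Lemma spectral_calc_lincomb a b F G x y :
  calc (fun z => a * F z + b * G z) x y = a * calc F x y + b * calc G x y.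
Proof.
rewrite !spectral_calcE !mulr_sumr -big_split.
by apply: eq_bigr => j _ /=; ring.
Qed.

Hypothesis frame : eigenframe H W mu.

Lemma spectral_calc_expr k : calc (fun z => z ^+ k) = H ^+ k.
Proof.
have [WH WtW] := frame.
rewrite -[RHS]mul1mx -WtW /spectral_calc -!mulmxA; congr (_ *m _).
elim: k => [|k IHk].
  rewrite expr0 mulmx1 (_ : map_mx _ mu = const_mx 1) ?diag_const_mx ?mul1mx //.
  by apply/rowP => j; rewrite !mxE expr0.
rewrite exprSr mulmxA -IHk -mulmxA WH mulmxA mulmx_diag; congr (diag_mx _ *m _).
by apply/rowP => j; rewrite !mxE exprSr.
Qed.

Lemma spectral_calc_id : calc id = H.
Proof. by rewrite -[RHS]expr1 -spectral_calc_expr. Qed.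

Lemma dot_eigenframe u w : dot u w = dot (u *m W^T) (w *m W^T).
Proof. by rewrite dot_mulmx trmxK -mulmxA frame.2 mulmx1. Qed.

Lemma eigenframe_row j : row j W *m H = mu 0 j *: row j W.
Proof.
by rewrite -row_mul frame.1 mul_diag_mx; apply/rowP => x; rewrite !mxE.
Qed.

Lemma eigenrow_spectral_calc F u l : u *m H = l *: u -> u *m calc F = F l *: u.
Proof.
move=> uH; rewrite -[in RHS](mulmx1 u) -frame.2 !mulmxA scalemxAl.
congr (_ *m _); apply/rowP => j.
rewrite mul_mx_diag [LHS]mxE [RHS]mxE [map_mx _ _ _ _]mxE mulrC -dot_row.
have [->|mu_neq] := eqVneq (mu 0 j) l; first by [].
have symH : H^T = H by rewrite -spectral_calc_id tr_spectral_calc.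
rewrite (dot_eigenrow_eq0 symH uH (eigenframe_row j)) ?mulr0 // eq_sym.
exact: mu_neq.
Qed.

Lemma spectral_calc_bound F c u w : (forall z, `|F z| <= c) ->
  `|dot (u *m calc F) w| <= c * ((dot u u + dot w w) / 2).
Proof.
move=> Fc; rewrite dot_spectral_calc !(dot_eigenframe _ _) !dotE -big_split /=.
rewrite mulr_suml mulr_sumr; apply: le_trans (ler_norm_sum _ _ _) _.
apply: ler_sum => j _; rewrite normrM; apply: ler_pM => //.
set a := (u *m _) 0 j; set b := (w *m _) 0 j; rewrite ler_norml.
have := sqr_ge0 (a + b); have := sqr_ge0 (a - b); rewrite sqrrB sqrrD => ? ?.
by apply/andP; split; lra.
Qed.

End Eigenframe.

Section SymmetricMatrix.
Import complex.
Variable R : rcfType.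

Lemma map_Re_mulmx m n p (A : 'M[R[i]]_(m, n)) (B : 'M[R[i]]_(n, p)) :
  map_mx (@Re R) (A *m B) = map_mx (@Re R) A *m map_mx (@Re R) B -
    map_mx (@Im R) A *m map_mx (@Im R) B.
Proof.
apply/matrixP => x y; rewrite !mxE -sumrB.
rewrite (big_morph (@Re R) (id1 := 0) (op1 := +%R)) // => [|[? ?] [? ?]] //.
by apply: eq_bigr => z _; rewrite !mxE; case: (A x z); case: (B z y).
Qed.

Lemma map_Im_mulmx m n p (A : 'M[R[i]]_(m, n)) (B : 'M[R[i]]_(n, p)) :
  map_mx (@Im R) (A *m B) = map_mx (@Re R) A *m map_mx (@Im R) B +
    map_mx (@Im R) A *m map_mx (@Re R) B.
Proof.
apply/matrixP => x y; rewrite !mxE -big_split /=.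
rewrite (big_morph (@Im R) (id1 := 0) (op1 := +%R)) // => [|[? ?] [? ?]] //.
by apply: eq_bigr => z _; rewrite !mxE; case: (A x z); case: (B z y).
Qed.

Lemma map_Re_real m n (A : 'M[R]_(m, n)) :
  map_mx (@Re R) (map_mx (real_complex R) A) = A.
Proof. by apply/matrixP => x y; rewrite !mxE. Qed.

Lemma map_Im_real m n (A : 'M[R]_(m, n)) :
  map_mx (@Im R) (map_mx (real_complex R) A) = 0.
Proof. by apply/matrixP => x y; rewrite !mxE. Qed.

Lemma symmetric_unitary_diag n (H : 'M[R]_n) : H^T = H ->
  exists (P : 'M[R[i]]_n) (d : 'rV[R]_n),
    P *m map_mx (real_complex R) H = map_mx (real_complex R) (diag_mx d) *m P /\
    map_mx Num.conj P^T *m P = 1%:M.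
Proof.
move=> symH; set HC := map_mx _ H.
have HCherm : HC \is hermsymmx.
  apply: realsym_hermsym.
    by apply/is_hermitianmxP; rewrite expr0 scale1r map_mx_id // map_trmx symH.
  by apply/mxOverP=> i j; rewrite mxE; apply/complex_realP; eexists.
pose P := spectralmx HC; pose D := spectral_diag HC.
have Punit : P \is unitarymx := spectral_unitarymx HC.
exists P, (map_mx (@Re R) D); split; last exact/mulmx1C/unitarymxP.
have /hermitian_normalmx/orthomx_spectralP {1}-> := HCherm.
rewrite -/P -/D !mulmxA mulmxV ?mul1mx ?unitarymx_unit // map_diag_mx.
congr (diag_mx _ *m _); apply/rowP => j; rewrite 2!mxE [RHS]RRe_real //.
exact: (mxOverP (hermitian_spectral_diag_real HCherm)).
Qed.

(* The real and imaginary parts of a complex unitary eigenbasis are real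
   eigenvectors: this replaces the spectral theorem over the reals. *)
Lemma symmetric_eigenframe n (H : 'M[R]_n) : H^T = H ->
  exists (W : 'M[R]_(n + n, n)) (mu : 'rV[R]_(n + n)), eigenframe H W mu.
Proof.
move=> /symmetric_unitary_diag[P [d [PH PstarP]]].
pose X := map_mx (@Re R) P; pose Y := map_mx (@Im R) P.
exists (col_mx X Y), (row_mx d d); split.
  rewrite mul_col_mx diag_mx_row mul_block_col !mul0mx addr0 add0r.
  have := congr1 (map_mx (@Re R)) PH; have := congr1 (map_mx (@Im R)) PH.
  rewrite !map_Im_mulmx !map_Re_mulmx !map_Re_real !map_Im_real.
  by rewrite !(mulmx0, mul0mx, add0r, addr0, subr0) => -> ->.
have := congr1 (map_mx (@Re R)) PstarP.
rewrite map_Re_mulmx tr_col_mx mul_row_col.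
have -> : map_mx (@Re R) 1%:M = 1%:M :> 'M[R]_n.
  by apply/matrixP => x y; rewrite !mxE; case: eqP.
have -> : map_mx (@Re R) (map_mx Num.conj P^T) = X^T.
  by apply/matrixP => x y; rewrite !mxE; case: (P y x).
have -> : map_mx (@Im R) (map_mx Num.conj P^T) = - Y^T.
  by apply/matrixP => x y; rewrite !mxE; case: (P y x).
by rewrite mulNmx opprK.
Qed.

End SymmetricMatrix.

Lemma rayleigh_eigenrow (R : rcfType) n (H : 'M[R]_n) (u : 'rV[R]_n) c :
  H^T = H ->
  c * dot u u < dot (u *m H) u ->
  exists (phi : 'rV[R]_n) (l : R),
    [/\ phi *m H = l *: phi, c < l & dot phi u != 0].
Proof.
move=> /symmetric_eigenframe[W [mu frame]] cuu.
have [/existsP[j /andP[cj uj]]|/existsPn small] :=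
    boolP [exists j, (c < mu 0 j) && ((u *m W^T) 0 j != 0)].
  exists (row j W), (mu 0 j); split=> //; first exact: eigenframe_row.
  by rewrite dotC dot_row.
move: cuu; rewrite -(spectral_calc_id frame) dot_spectral_calc.
rewrite (dot_eigenframe frame) dotE mulr_sumr ltNge; case/negP.
apply: ler_sum => j _; have := small j; rewrite negb_and -leNgt negbK.
case/orP => [muj|/eqP ->]; last by rewrite !(mul0r, mulr0).
by rewrite ler_wpM2r // -expr2 sqr_ge0.
Qed.

Lemma sqr_lincomb_le (R : realDomainType) (c s p q : R) : c ^+ 2 + s ^+ 2 = 1 ->
  (c * p + s * q) ^+ 2 <= p ^+ 2 + q ^+ 2.
Proof.
move=> cs_sqr; have -> : p ^+ 2 + q ^+ 2 =
    (c * p + s * q) ^+ 2 + (c * q - s * p) ^+ 2.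
  by rewrite -[LHS]mul1r -cs_sqr; ring.
by rewrite lerDl sqr_ge0.
Qed.

Section TransferProbability.
Variables (R : realType) (m n : nat).
Variables (H : 'M[R]_n) (W : 'M[R]_(m, n)) (mu : 'rV[R]_m).
Hypothesis frame : eigenframe H W mu.
Implicit Types (t : R) (x y : 'I_n).
Local Notation calc := (spectral_calc W mu).

Lemma cvg_series_spectral_calc (F : R -> R) (a : nat -> R) (p : nat -> nat)
    x y :
  (forall z, (series (fun k => a k * z ^+ p k) @ \oo --> F z)%classic) ->
  (series (fun k => a k * (H ^+ p k) x y) @ \oo --> calc F x y)%classic.
Proof.
move=> cvgF; rewrite spectral_calcE.
rewrite (_ : series _ = fun N => \sum_j
    series (fun k => a k * mu 0 j ^+ p k) N * (W j x * W j y)).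
  apply: cvg_big => [|j _]; first exact: add_continuous.
  by apply: cvgM; [exact: cvgF | exact: cvg_cst].
apply/funext => N; rewrite /series /=; under [RHS]eq_bigr do rewrite mulr_suml.
rewrite exchange_big /=; apply: eq_bigr => k _.
rewrite -(spectral_calc_expr frame) spectral_calcE mulr_sumr.
by apply: eq_bigr => j _; rewrite !mulrA.
Qed.

Lemma cos_entryE t x y : cos_entry H t x y = calc (fun z => cos (z * t)) x y.
Proof.
apply: cvg_lim => //; apply: cvg_series_spectral_calc => z.
rewrite [X in series X](_ : _ = cos_coeff' (z * t)).
  exact: cvg_cos_coeff'.
by apply/funext => k; rewrite /cos_coeff' mul2n exprMn -exprnP; ring.
Qed.

Lemma sin_entryE t x y : sin_entry H t x y = calc (fun z => sin (z * t)) x y.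
Proof.
apply: cvg_lim => //; apply: cvg_series_spectral_calc => z.
rewrite [X in series X](_ : _ = sin_coeff' (z * t)).
  exact: cvg_sin_coeff'.
by apply/funext => k; rewrite /sin_coeff' mul2n exprMn -exprnP; ring.
Qed.

Lemma transfer_prob_ge_sqr x y theta t :
  calc (fun z => cos (theta - z * t)) x y ^+ 2 <= transfer_prob H x y t.
Proof.
rewrite /transfer_prob cos_entryE sin_entryE.
rewrite (_ : (fun z => _) = fun z : R =>
    cos theta * cos (z * t) + sin theta * sin (z * t)); last first.
  by apply/funext => z; rewrite cosB.
by rewrite spectral_calc_lincomb; apply/sqr_lincomb_le/cos2Dsin2.
Qed.

Lemma transfer_prob_le1 x y t : transfer_prob H x y t <= 1.
Proof.
rewrite /transfer_prob cos_entryE sin_entryE.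
set p := calc _ x y; set q := calc _ x y; set r := p ^+ 2 + q ^+ 2.
have r_ge0 : 0 <= r by rewrite addr_ge0 ?sqr_ge0.
have : `|calc (fun z => p * cos (z * t) + q * sin (z * t)) x y| <= Num.sqrt r.
  rewrite -dot_delta_mulmx; apply: le_trans (spectral_calc_bound frame _ _ _) _.
    move=> z; rewrite -sqrtr_sqr; apply: ler_wsqrtr.
    by rewrite mulrC [q * _]mulrC; apply/sqr_lincomb_le/cos2Dsin2.
  by rewrite !dot_delta !mxE !eqxx -[X in _ * X]/(2 / 2) divff // mulr1.
rewrite spectral_calc_lincomb -/p -/q -!expr2 -/r ger0_norm //.
by have := sqr_sqrtr r_ge0; rewrite expr2; nra.
Qed.

End TransferProbability.

Lemma transfer_prob_le_fidelity (R : realType) n (H : 'M[R]_n) x y t :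
  H^T = H -> 0 <= t -> transfer_prob H x y t <= fidelity H x y.
Proof.
move=> /symmetric_eigenframe[W [mu frame]] t_ge0.
apply: ub_le_sup; last by exists t.
by exists 1 => _ [r _ <-]; exact: transfer_prob_le1 frame _ _ _.
Qed.

Definition weight (R : fieldType) n (phi : 'rV[R]_n) x : R :=
  phi 0 x ^+ 2 / dot phi phi.

Lemma opposite_modes_entry_le (R : realFieldType) n (K : 'M[R]_n)
    (phi psi : 'rV[R]_n) x y :
  K^T = K -> (forall u w, dot (u *m K) w <= (dot u u + dot w w) / 2) ->
  phi *m K = -1 *: phi -> psi *m K = 1 *: psi -> dot phi psi = 0 ->
  phi 0 y = phi 0 x -> psi 0 y = - psi 0 x ->
  K x y <= 1 - 2 * (weight phi x + weight psi x).
Proof.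
move=> symK K_le phiK psiK ort phi_y psi_y.
pose rest z := residual psi (residual phi (delta_mx 0 z)).
have delta_dot z (u : 'rV[R]_n) : dot (delta_mx 0 z) u = u 0 z.
  by rewrite dotC dot_delta.
have restK : dot (rest x *m K) (rest y) = K x y + (weight phi x + weight psi x).
  rewrite (dot_residual_pair _ _ symK phiK psiK ort) dot_delta_mulmx !delta_dot.
  by rewrite phi_y psi_y /weight; ring.
have rest_mass z : dot (rest z) (rest z) = 1 - (weight phi z + weight psi z).
  have id1 (u : 'rV[R]_n) : u *m 1%:M = 1 *: u by rewrite mulmx1 scale1r.
  have := dot_residual_pair (delta_mx 0 z) (delta_mx 0 z) (trmx1 _ _)
    (id1 phi) (id1 psi) ort.
  rewrite !mulmx1 !delta_dot => ->; rewrite mxE !eqxx /= /weight; ring.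
have weight_y : weight phi y + weight psi y = weight phi x + weight psi x.
  by rewrite /weight phi_y psi_y sqrrN.
by have := K_le (rest x) (rest y); rewrite restK !rest_mass weight_y; lra.
Qed.

(* At time [t] the two modes have acquired opposite phases, so their amplitudes
   from [x] to [y] add up. *)
Lemma two_mode_transfer (R : realType) n (H : 'M[R]_n) (phi psi : 'rV[R]_n)
    k l x y t :
  H^T = H -> phi *m H = k *: phi -> psi *m H = l *: psi ->
  phi 0 y = phi 0 x -> psi 0 y = - psi 0 x -> (k - l) * t = pi ->
  1 - 4 * (1 - (weight phi x + weight psi x)) <= transfer_prob H x y t.
Proof.
move=> symH phiH psiH phi_y psi_y phase.
have kl : k != l.
  by apply: contra_eq_neq phase => ->; rewrite subrr mul0r lt_eqF ?pi_gt0.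
have ort := dot_eigenrow_eq0 symH phiH psiH kl.
have [W [mu frame]] := symmetric_eigenframe symH.
pose F z := cos (l * t - z * t); pose K := spectral_calc W mu F.
have phiK : phi *m K = -1 *: phi.
  rewrite (eigenrow_spectral_calc frame F phiH) /F.
  by rewrite -mulrBl -opprB mulNr phase cosN cospi.
have psiK : psi *m K = 1 *: psi.
  by rewrite (eigenrow_spectral_calc frame F psiH) /F subrr cos0.
have K_le u w : dot (u *m K) w <= (dot u u + dot w w) / 2.
  rewrite -[leRHS]mul1r; apply: le_trans (ler_norm _) _.
  apply: (spectral_calc_bound frame) => z.
  by rewrite ler_norml cos_geN1 cos_le1.
have Kxy : K x y <= 1 - 2 * (weight phi x + weight psi x).
  exact: (opposite_modes_entry_le (tr_spectral_calc W mu F)).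
apply: le_trans (transfer_prob_ge_sqr frame x y (l * t) t).
by rewrite -/F -/K; have := sqr_ge0 (K x y + 1); nra.
Qed.

Lemma is_dist_upath n (e : rel 'I_n) x y d : is_dist e x y d ->
  exists p, [/\ size p = d, path e x p, last x p = y & uniq (x :: p)].
Proof.
move=> [[p [size_p [path_p last_p]]] dist_min].
case/shortenP: path_p last_p => q path_q uniq_q sub_qp last_q.
exists q; split=> //; apply/eqP; rewrite eqn_leq -{1}size_p.
rewrite dist_min ?andbT; last by exists q.
by rewrite uniq_leq_size //; have /andP[] := uniq_q.
Qed.

Definition nbr_sum (R : nmodType) n (e : rel 'I_n) (g : 'I_n -> R) x : R :=
  \sum_(y | e x y) g y.

Section NeighbourSum.
Variables (R : realFieldType) (n : nat) (e : rel 'I_n).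
Implicit Types (g a phi : 'I_n -> R) (A : pred 'I_n).
Local Notation m := ((maxdeg e)%:R : R).

Lemma nbr_sum_le g c x :
  0 <= c -> (forall y, g y <= c) -> nbr_sum e g x <= m * c.
Proof.
move=> c_ge0 g_le; apply: (@le_trans _ _ (\sum_(y | e x y) c)).
  by apply: ler_sum => y _.
rewrite sumr_const -[leLHS]mulr_natl ler_wpM2r // ler_nat.
by apply: leq_trans (leq_bigmax x); rewrite cardsE.
Qed.

Lemma nbr_sumN g x : nbr_sum e (fun z => - g z) x = - nbr_sum e g x.
Proof. exact: sumrN. Qed.

Lemma nbr_sumB g a x :
  nbr_sum e (fun z => g z - a z) x = nbr_sum e g x - nbr_sum e a x.
Proof. exact: sumrB. Qed.

Lemma nbr_sum_shift_le g c x :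
  0 <= c -> nbr_sum e (fun z => g z + c) x <= nbr_sum e g x + m * c.
Proof.
by move=> c_ge0; rewrite /nbr_sum big_split lerD2l; exact: nbr_sum_le.
Qed.

Lemma nbr_le_nbr_sum g x y :
  (forall z, 0 <= g z) -> e x y -> g y <= nbr_sum e g x.
Proof.
by move=> g_ge0 exy; rewrite /nbr_sum (bigD1 y) //= lerDl sumr_ge0.
Qed.

Lemma min_principle A g L eps : m < L -> 0 <= eps ->
  (forall x, x \in A -> 0 <= g x) ->
  (forall x, x \notin A -> nbr_sum e g x <= L * g x + eps) ->
  forall x, - (eps / (L - m)) <= g x.
Proof.
move=> mL eps_ge0 gA superA x; have Lm : 0 < L - m by rewrite subr_gt0.
case: (@arg_minP _ _ _ x predT g) => // z _ z_min.
apply: le_trans (z_min x isT).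
rewrite lerNl ler_pdivlMr //.
have [gz_ge0|gz_lt0] := leP 0 (g z); first by nra.
have zA : z \notin A by apply: contraL gz_lt0 => /gA; rewrite leNgt.
have : nbr_sum e (fun y => - g y) z <= m * - g z.
  apply: nbr_sum_le => [|y]; first by rewrite oppr_ge0 ltW.
  by rewrite lerN2; exact: z_min.
by rewrite nbr_sumN; have := superA z zA; lra.
Qed.

Lemma norm_max_principle A phi l c : m < l -> 0 <= c ->
  (forall x, x \in A -> `|phi x| <= c) ->
  (forall x, x \notin A -> nbr_sum e phi x = l * phi x) ->
  forall x, `|phi x| <= c.
Proof.
move=> ml c_ge0 phiA eqA x.
have upper psi : (forall z, z \in A -> psi z <= c) ->
    (forall z, z \notin A -> nbr_sum e psi z = l * psi z) -> psi x <= c.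
  move=> psiA eq_psi; pose g z := c - psi z.
  rewrite -subr_ge0 -[leLHS]oppr0 -(mul0r (l - m)^-1).
  apply: (@min_principle A g l 0) => // z zA; rewrite /g ?subr_ge0 ?psiA //.
  by rewrite nbr_sumB eq_psi //; have := nbr_sum_le z c_ge0 (fun=> lexx c); nra.
rewrite ler_norml; apply/andP; split; last first.
  by apply: upper => // z /phiA; rewrite ler_norml => /andP[].
rewrite lerNl; apply: (upper (fun z => - phi z)) => z zA.
  by rewrite lerNl; have := phiA z zA; rewrite ler_norml => /andP[].
by rewrite nbr_sumN eqA // mulrN.
Qed.

Lemma supersolution_path g L x p : 0 <= L -> (forall z, 0 <= g z) ->
  path e x p -> {in belast x p, forall z, nbr_sum e g z <= L * g z} ->
  g (last x p) <= L ^+ size p * g x.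
Proof.
move=> L_ge0 g_ge0; elim: p x => [|y p IHp] x /=; first by rewrite mul1r.
move=> /andP[exy path_p] super; rewrite exprSr -mulrA.
have := super x (mem_head _ _); have := nbr_le_nbr_sum g_ge0 exy => gy gx.
apply: le_trans (IHp y path_p _) _; last first.
  by rewrite ler_wpM2l ?exprn_ge0 ?(le_trans gy).
by move=> z zp; apply: super; rewrite inE zp orbT.
Qed.

Lemma supersolution_dist g L v v' d : 0 <= L -> (forall z, 0 <= g z) ->
  v != v' -> is_dist e v v' d ->
  (forall x, x \notin pred2 v v' -> nbr_sum e g x <= L * g x) ->
  g v' <= L ^+ d.-1 * nbr_sum e g v.
Proof.
move=> L_ge0 g_ge0 vv' /is_dist_upath[].
move=> [|y p] [size_p path_p last_p uniq_p] super.
  by move: vv'; rewrite -last_p eqxx.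
have /andP[evy path_yp] := path_p; have last_yp : last y p = v' := last_p.
have /andP[v_notin] : (v \notin y :: p) && uniq (y :: p) := uniq_p.
rewrite lastI rcons_uniq last_yp => /andP[v'_notin _].
have g_le : g v' <= L ^+ d.-1 * g y.
  rewrite -last_yp -size_p; apply: supersolution_path => // z zp.
  apply: super; rewrite !inE negb_or; apply/andP; split.
    by apply: contraNneq v_notin => <-; exact: mem_belast.
  by apply: contraNneq v'_notin => <-.
by apply: le_trans g_le _; rewrite ler_wpM2l ?exprn_ge0 ?nbr_le_nbr_sum.
Qed.

Hypothesis sym_e : symmetric e.

Lemma sum_nbr_sum_le a : (forall x, 0 <= a x) ->
  \sum_x nbr_sum e a x <= m * \sum_x a x.
Proof.
move=> a_ge0; rewrite /nbr_sum (exchange_big_dep predT) //= mulr_sumr.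
apply: ler_sum => y _; rewrite (eq_bigl (e y)) => [|x]; last by rewrite sym_e.
exact: (nbr_sum_le (g := fun=> a y)).
Qed.

Lemma mass_off_le A phi l :
  (forall x, x \notin A -> nbr_sum e phi x = l * phi x) ->
  l * \sum_(x | x \notin A) phi x ^+ 2 <= m * \sum_x phi x ^+ 2.
Proof.
move=> eqA; pose sq x := phi x ^+ 2.
pose bound x := (m * sq x + nbr_sum e sq x) / 2.
have sq_ge0 x : 0 <= sq x by exact: sqr_ge0.
have bound_ge0 x : 0 <= bound x.
  by apply/divr_ge0/ler0n; apply: addr_ge0; [exact: mulr_ge0 | exact: sumr_ge0].
have amgm x : phi x * nbr_sum e phi x <= bound x.
  apply: (@le_trans _ _ (\sum_(y | e x y) (sq x + sq y) / 2)).
    rewrite mulr_sumr; apply: ler_sum => y _.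
    by have := sqr_ge0 (phi x - phi y); rewrite /sq; nra.
  rewrite -mulr_suml ler_pM2r // big_split lerD2r.
  exact: (nbr_sum_le (g := fun=> sq x)).
apply: (@le_trans _ _ (\sum_x bound x)).
  rewrite mulr_sumr big_mkcond /=; apply: ler_sum => x _.
  by case: ifPn => // xA; rewrite expr2 mulrCA -eqA // amgm.
rewrite -mulr_suml big_split -mulr_sumr /= ler_pdivrMr //.
by have := sum_nbr_sum_le sq_ge0; lra.
Qed.

End NeighbourSum.

Definition endpoint_vector (R : nzRingType) n (v v' : 'I_n) (b : R)
    : 'rV[R]_n :=
  delta_mx 0 v + b *: delta_mx 0 v'.

Lemma dot_endpoint_vector (R : comNzRingType) n (v v' : 'I_n) (b : R) u :
  dot u (endpoint_vector v v' b) = u 0 v + b * u 0 v'.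
Proof. by rewrite dotDr dotZr !dot_delta. Qed.

Lemma dot_endpoint_vector2 (R : comNzRingType) n (v v' : 'I_n) (b : R) :
  v != v' -> b ^+ 2 = 1 ->
  dot (endpoint_vector v v' b) (endpoint_vector v v' b) = 2.
Proof.
move=> vv' b_sqr; rewrite dot_endpoint_vector !mxE !eqxx.
rewrite [v' == v]eq_sym (negbTE vv') /=.
by rewrite !(mulr0, addr0, add0r, mulr1) -expr2 b_sqr.
Qed.

Section Hamiltonian.
Variables (R : comNzRingType) (n : nat) (e : rel 'I_n) (Q : R) (v v' : 'I_n).
Hypothesis sym_e : symmetric e.
Local Notation H := (hamil e Q v v').

Lemma tr_hamil : H^T = H.
Proof.
apply/matrixP => x y; rewrite !mxE sym_e; congr (_ + _).
by rewrite (eq_sym y); case: eqP => //= ->.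
Qed.

Lemma mulmx_hamil (phi : 'rV[R]_n) x : (phi *m H) 0 x =
  nbr_sum e (phi 0) x + (if x \in pred2 v v' then Q * phi 0 x else 0).
Proof.
rewrite mxE; under eq_bigr do rewrite !mxE mulrDr.
rewrite big_split /=; congr (_ + _).
  rewrite /nbr_sum [RHS]big_mkcond; apply: eq_bigr => y _.
  by rewrite sym_e; case: (e x y); rewrite ?mulr1 ?mulr0.
rewrite (bigD1 x) //= eqxx big1 ?addr0; last first.
  by move=> y /negbTE ->; rewrite mulr0.
by rewrite inE /=; case: ifP => _; rewrite ?mulr0 // mulrC.
Qed.

Lemma dot_endpoint_vector_hamil (b : R) :
  irreflexive e -> v != v' -> b ^+ 2 = 1 ->
  dot (endpoint_vector v v' b *m H) (endpoint_vector v v' b) =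
  2 * (Q + b * (e v v')%:R).
Proof.
move=> irr_e vv' b_sqr; have v'v : v' != v by rewrite eq_sym.
rewrite dot_endpoint_vector mulmxDl -scalemxAl -!rowE !mxE !eqxx orbT !irr_e.
rewrite (negbTE vv') (negbTE v'v) (sym_e v') /=.
transitivity ((1 + b ^+ 2) * Q + 2 * b * (e v v')%:R); first by ring.
by rewrite b_sqr; ring.
Qed.

End Hamiltonian.

Definition eigenmode (R : pzRingType) n (H : 'M[R]_n) v v' (b l : R)
    (phi : 'rV[R]_n) : Prop :=
  [/\ phi *m H = l *: phi, phi 0 v = 1 & phi 0 v' = b].

Section Eigenmode.
Variables (R : realFieldType) (n : nat) (e : rel 'I_n) (Q : R) (v v' : 'I_n).
Variables (b l : R) (phi : 'rV[R]_n).
Hypotheses (sym_e : symmetric e) (b_sqr : b ^+ 2 = 1).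
Hypothesis mode : eigenmode (hamil e Q v v') v v' b l phi.
Local Notation m := ((maxdeg e)%:R : R).

Lemma eigenmode_eq x : nbr_sum e (phi 0) x +
  (if x \in pred2 v v' then Q * phi 0 x else 0) = l * phi 0 x.
Proof. by have [phiH _ _] := mode; rewrite -mulmx_hamil // phiH mxE. Qed.

Lemma eigenmode_nbr_off x : x \notin pred2 v v' ->
  nbr_sum e (phi 0) x = l * phi 0 x.
Proof. by move=> /negbTE xv; rewrite -eigenmode_eq xv addr0. Qed.

Lemma eigenmode_nbr_source : nbr_sum e (phi 0) v = l - Q.
Proof.
have [_ phiv _] := mode; have := eigenmode_eq v.
by rewrite inE eqxx /= phiv !mulr1 => <-; rewrite addrK.
Qed.

Lemma eigenmode_norm_le1 : m < l -> forall x, `|phi 0 x| <= 1.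
Proof.
move=> ml; have [_ phiv phiv'] := mode.
apply: norm_max_principle ml ler01 _ eigenmode_nbr_off => x.
rewrite !inE => /orP[] /eqP ->; first by rewrite phiv normr1.
by have /eqP := b_sqr; rewrite sqr_norm_eq1 phiv' => /eqP ->.
Qed.

Lemma eigenmode_value_le : m < l -> l <= Q + m.
Proof.
move=> ml; rewrite -lerBlDl -eigenmode_nbr_source -[leRHS]mulr1.
apply: nbr_sum_le => // y.
exact: le_trans (ler_norm _) (eigenmode_norm_le1 ml y).
Qed.

Lemma eigenmode_weight_ge : v != v' -> 0 < l -> (1 - m / l) / 2 <= weight phi v.
Proof.
move=> vv' l_gt0; have [_ phiv phiv'] := mode.
have mass := mass_off_le sym_e eigenmode_nbr_off.
set S := \sum_(x | _) _ in mass; set N := \sum_x _ in mass.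
have S_ge0 : 0 <= S by apply: sumr_ge0 => x _; exact: sqr_ge0.
have N_split : N = 2 + S.
  rewrite /N (bigD1 v) //= (bigD1 v') 1?eq_sym //=.
  rewrite phiv phiv' b_sqr expr1n addrA.
  by congr (_ + _); apply: eq_bigl => x; rewrite !inE negb_or.
have dotN : dot phi phi = N.
  by rewrite dotE; apply: eq_bigr => x _; rewrite expr2.
have S_le : S <= m / l * N by rewrite mulrAC ler_pdivlMr // mulrC.
rewrite /weight dotN phiv expr1n ler_pdivlMr; last by lra.
by move: S_le; rewrite N_split; lra.
Qed.

End Eigenmode.

Section EigenvalueGap.
Variables (R : realFieldType) (n : nat) (e : rel 'I_n) (Q : R) (v v' : 'I_n).
Variables (d : nat) (k l : R) (phi psi : 'rV[R]_n).
Hypotheses (sym_e : symmetric e) (vv' : v != v') (dist_d : is_dist e v v' d).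
Hypothesis phi_mode : eigenmode (hamil e Q v v') v v' 1 k phi.
Hypothesis psi_mode : eigenmode (hamil e Q v v') v v' (-1) l psi.
Local Notation m := ((maxdeg e)%:R : R).
Hypotheses (mk : m < k) (ml : m < l).
Local Notation mean := ((k + l) / 2).
Local Notation diff := (fun x => phi 0 x - psi 0 x).
Local Notation shift := (`|k - l| / (mean - m)).

Let shift_ge0 : 0 <= shift.
Proof. by rewrite divr_ge0 // subr_ge0; move: mk ml; lra. Qed.

Let shiftE : shift * (mean - m) = `|k - l|.
Proof. by rewrite divfK // subr_eq0 gt_eqF //; move: mk ml; lra. Qed.

Lemma nbr_sum_diff_le x : x \notin pred2 v v' ->
  nbr_sum e diff x <= mean * diff x + `|k - l|.
Proof.
move=> xv; rewrite nbr_sumB.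
rewrite (eigenmode_nbr_off sym_e phi_mode) //.
rewrite (eigenmode_nbr_off sym_e psi_mode) //.
have -> : k * phi 0 x - l * psi 0 x =
    mean * diff x + (k - l) * ((phi 0 x + psi 0 x) / 2) by field.
rewrite lerD2l; apply: le_trans (ler_norm _) _; rewrite normrM ler_piMr //.
have := eigenmode_norm_le1 sym_e (expr1n _ _) phi_mode mk x.
have opp1_sqr : (-1) ^+ 2 = 1 :> R by rewrite sqrrN expr1n.
have := eigenmode_norm_le1 sym_e opp1_sqr psi_mode ml x.
by rewrite !ler_norml => /andP[? ?] /andP[? ?]; apply/andP; split; lra.
Qed.

Lemma shifted_diff_ge0 x : 0 <= diff x + shift.
Proof.
have [_ phiv phiv'] := phi_mode; have [_ psiv psiv'] := psi_mode.
rewrite -lerBlDr sub0r.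
apply: (@min_principle _ _ e (pred2 v v') diff mean) => //.
- by move: mk ml; lra.
- move=> z; rewrite !inE => /orP[] /eqP ->; first by rewrite phiv psiv subrr.
  by rewrite phiv' psiv'; lra.
- exact: nbr_sum_diff_le.
Qed.

Lemma shifted_diff_super x : x \notin pred2 v v' ->
  nbr_sum e (fun z => diff z + shift) x <= mean * (diff x + shift).
Proof.
move=> xv; have := nbr_sum_shift_le e diff x shift_ge0.
by have := nbr_sum_diff_le xv; move: shiftE; lra.
Qed.

(* The shifted difference of the two modes is at least [2] at [v'], while the
   sum of its values next to [v] is controlled by the gap. *)
Lemma eigenvalue_gap :
  3 * m <= mean -> 1 <= mean -> 1 <= (k - l) * mean ^+ d.-1.
Proof.
move=> m3_le mean_ge1; have mean_ge0 : 0 <= mean by exact: le_trans mean_ge1.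
have [_ _ phiv'] := phi_mode; have [_ _ psiv'] := psi_mode.
have := supersolution_dist mean_ge0 shifted_diff_ge0 vv' dist_d
  shifted_diff_super.
set g_nbrs := nbr_sum e _ v => two_le.
have nbrs_le : g_nbrs <= (k - l) + `|k - l| / 2.
  apply: le_trans (nbr_sum_shift_le _ _ _ shift_ge0) _.
  rewrite nbr_sumB (eigenmode_nbr_source sym_e phi_mode).
  rewrite (eigenmode_nbr_source sym_e psi_mode) opprB addrA subrK lerD2l.
  have : 0 <= shift * (mean - 3 * m) by rewrite mulr_ge0 // subr_ge0.
  by move: shiftE; lra.
have pow_ge0 : 0 <= mean ^+ d.-1 by exact: exprn_ge0.
have {two_le} : 2 <= mean ^+ d.-1 * (k - l + `|k - l| / 2).
  apply: le_trans (le_trans two_le (ler_wpM2l pow_ge0 nbrs_le)).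
  by rewrite phiv' psiv'; move: shift_ge0; lra.
have [kl|kl] := leP 0 (k - l); first by rewrite ger0_norm //; lra.
by rewrite ltr0_norm //; nra.
Qed.

End EigenvalueGap.

Lemma colsub_mulmx (R : pzSemiRingType) n (s : 'I_n -> 'I_n) (M : 'M[R]_n)
    (u : 'rV[R]_n) :
  injective s -> mxsub s s M = M -> colsub s u *m M = colsub s (u *m M).
Proof.
move=> s_inj sM; apply/rowP => x; rewrite !mxE [RHS](reindex_inj s_inj).
by apply: eq_bigr => y _; rewrite -{1}sM !mxE.
Qed.

Section Involution.
Variables (R : rcfType) (n : nat) (e : rel 'I_n) (Q : R) (s : 'I_n -> 'I_n).
Variable v : 'I_n.
Hypotheses (graph_e : simple_graph e) (inv_s : graph_involution e s).
Local Notation H := (hamil e Q v (s v)).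

Lemma mxsub_hamil : mxsub s s H = H.
Proof.
have [ssx es] := inv_s; have s_inj : injective s := can_inj ssx.
have e_s x y : e (s x) (s y) = e x y by apply/idP/idP => /es; rewrite ?ssx.
apply/matrixP => x y; rewrite !mxE e_s !(inj_eq s_inj); congr (_ + _).
by rewrite -(inj_eq s_inj (s x)) ssx orbC.
Qed.

Lemma involution_eigenmode b : s v != v -> b ^+ 2 = 1 ->
  exists (l : R) (phi : 'rV[R]_n), eigenmode H v (s v) b l phi /\ Q - 2 < l.
Proof.
move=> sv b_sqr; have [sym_e irr_e] := graph_e; have [ssx _] := inv_s.
have symH := tr_hamil Q v (s v) sym_e.
have vsv : v != s v by rewrite eq_sym.
have irr x : e x x = false by apply/negbTE.
have [|chi [l [chiH Ql]]] := rayleigh_eigenrow (c := Q - 2)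
  (u := endpoint_vector v (s v) b) symH.
  rewrite dot_endpoint_vector2 // dot_endpoint_vector_hamil //.
  have : `|b| <= 1 by have /eqP := b_sqr; rewrite sqr_norm_eq1 => /eqP ->.
  by rewrite ler_norml => /andP[? ?]; case: (e v (s v)) => /=; lra.
rewrite dot_endpoint_vector; set c := chi 0 v + _ => c_neq0.
pose phi := c^-1 *: (chi + b *: colsub s chi).
have phi_v : phi 0 v = 1 by rewrite !mxE mulVf.
exists l, phi; split=> //; split=> //.
  rewrite -scalemxAl mulmxDl -scalemxAl.
  rewrite (colsub_mulmx _ (can_inj ssx) mxsub_hamil) chiH.
  by apply/rowP => x; rewrite !mxE; ring.
rewrite -[RHS]mulr1 -phi_v !mxE ssx mulrCA; congr (_ * _).
by rewrite mulrDr mulrA -expr2 b_sqr mul1r addrC.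
Qed.

End Involution.

Lemma maxdeg_gt0 n (e : rel 'I_n) x y k :
  walk e x y k -> x != y -> (0 < maxdeg e)%N.
Proof.
move=> [[|z p] [_ [/= path_p last_p]]]; first by rewrite last_p eqxx.
move=> _; apply: leq_trans (leq_bigmax x); apply/card_gt0P; exists z.
by have /andP[exz _] := path_p; rewrite inE.
Qed.

Section TransferTime.
Variables (R : realType) (n : nat) (e : rel 'I_n) (s : 'I_n -> 'I_n).
Variables (v : 'I_n) (d : nat) (Q : R).
Hypotheses (graph_e : simple_graph e) (inv_s : graph_involution e s).
Hypotheses (sv : s v != v) (dist_d : is_dist e v (s v) d).
Local Notation m := ((maxdeg e)%:R : R).
Local Notation H := (hamil e Q v (s v)).
Local Notation p := (transfer_prob H v (s v)).

Let sym_e : symmetric e := graph_e.1.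

Let vsv : v != s v.
Proof. by rewrite eq_sym. Qed.

Let one_sqr : 1 ^+ 2 = 1 :> R.
Proof. exact: expr1n. Qed.

Let opp1_sqr : (-1) ^+ 2 = 1 :> R.
Proof. by rewrite sqrrN. Qed.

Section ModePair.
Variables (k l : R) (phi psi : 'rV[R]_n).
Hypothesis phi_mode : eigenmode H v (s v) 1 k phi.
Hypothesis psi_mode : eigenmode H v (s v) (-1) l psi.

Lemma mode_pair_gap : 3 * (m + 1) <= Q -> Q - 2 < k -> Q - 2 < l ->
  1 <= (k - l) * (2 * Q) ^+ d.-1 /\ 0 < k - l.
Proof.
move=> Qm Qk Ql; have m_ge0 : 0 <= m by exact: ler0n.
have mk : m < k by lra.
have ml : m < l by lra.
set mean := (k + l) / 2.
have gap : 1 <= (k - l) * mean ^+ d.-1.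
  apply: (eigenvalue_gap sym_e vsv dist_d phi_mode psi_mode) => //;
    by rewrite /mean; lra.
have mean_gt0 : 0 < mean by rewrite /mean; lra.
have mean_le : mean <= 2 * Q.
  have := eigenmode_value_le sym_e one_sqr phi_mode mk.
  have := eigenmode_value_le sym_e opp1_sqr psi_mode ml.
  by rewrite /mean; lra.
have kl_gt0 : 0 < k - l.
  by rewrite -(pmulr_lgt0 _ (exprn_gt0 d.-1 mean_gt0)) (lt_le_trans _ gap).
split=> //; apply: le_trans gap _; rewrite ler_wpM2l ?(ltW kl_gt0) //.
by apply: lerXn2r => //; rewrite nnegrE; lra.
Qed.

Lemma mode_pair_transfer t : 2 < Q -> Q - 2 < k -> Q - 2 < l ->
  (k - l) * t = pi -> 1 - 4 * (m / (Q - 2)) <= p t.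
Proof.
move=> Q_gt2 Qk Ql phase.
have [phiH phiv phisv] := phi_mode; have [psiH psiv psisv] := psi_mode.
have Q2_gt0 : 0 < Q - 2 by rewrite subr_gt0.
have defect c : Q - 2 < c -> m / c <= m / (Q - 2).
  by move=> Qc; rewrite ler_wpM2l // lef_pV2 ?posrE ?ltW // (lt_trans Q2_gt0).
apply: le_trans (two_mode_transfer (tr_hamil _ _ _ sym_e) phiH psiH _ _ phase);
  last 2 first.
- by rewrite phisv phiv.
- by rewrite psisv psiv.
have := eigenmode_weight_ge sym_e one_sqr phi_mode vsv (lt_trans Q2_gt0 Qk).
have := eigenmode_weight_ge sym_e opp1_sqr psi_mode vsv (lt_trans Q2_gt0 Ql).
by have := defect k Qk; have := defect l Ql; lra.
Qed.

End ModePair.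

Lemma transfer_time_linear_defect : 3 * (m + 1) <= Q ->
  exists t : R, [/\ 0 <= t, t <= pi * (2 * Q) ^+ d.-1 &
    1 - 4 * (m / (Q - 2)) <= p t].
Proof.
move=> Qm.
have [k [phi [phi_mode Qk]]] :=
  involution_eigenmode Q graph_e inv_s sv one_sqr.
have [l [psi [psi_mode Ql]]] :=
  involution_eigenmode Q graph_e inv_s sv opp1_sqr.
have [gap kl_gt0] := mode_pair_gap phi_mode psi_mode Qm Qk Ql.
exists (pi / (k - l)); split.
- by rewrite divr_ge0 ?pi_ge0 // ltW.
- by rewrite ler_pdivrMr // -mulrA ler_peMr ?pi_ge0 // mulrC.
- apply: (mode_pair_transfer phi_mode psi_mode) => //.
    by have : 0 <= m by []; lra.
  by rewrite mulrC divfK // gt_eqF.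
Qed.

Lemma transfer_time_sqrt_defect : m <= Q ->
  exists t : R, [/\ 0 <= t, t <= pi * (2 * Q) ^+ d.-1 &
    1 - 16 * Num.sqrt (maxdeg e).+1%:R / Num.sqrt Q < p t].
Proof.
move=> mQ; have m_ge1 : 1 <= m.
  by rewrite ler1n; apply: maxdeg_gt0 dist_d.1 _; rewrite eq_sym.
have Q_gt0 : 0 < Q by lra.
pose q : R := Num.sqrt (maxdeg e).+1%:R / Num.sqrt Q.
have q_gt0 : 0 < q by rewrite divr_gt0 ?sqrtr_gt0 ?ltr0n.
have q_sqr : q ^+ 2 * Q = m + 1.
  rewrite expr_div_n !sqr_sqrtr ?ler0n ?(ltW Q_gt0) //.
  by rewrite divfK ?gt_eqF // natr1.
rewrite -mulrA -/q; have [q_big|q_small] := ltP 1 (16 * q).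
  exists 0; split=> //.
    by rewrite mulr_ge0 ?pi_ge0 // exprn_ge0 // mulr_ge0 // ltW.
  by apply: (@lt_le_trans _ _ 0); [lra | rewrite addr_ge0 ?sqr_ge0].
have m_le : 256 * (m + 1) <= Q.
  by rewrite -q_sqr mulrA ler_piMl ?(ltW Q_gt0) //; nra.
have [|t [t_ge0 t_le p_ge]] := transfer_time_linear_defect; first by lra.
exists t; split=> //; apply: lt_le_trans p_ge; rewrite ltrD2l ltrN2.
have : m / (Q - 2) < 4 * q; last by lra.
rewrite ltr_pdivrMr; last by lra.
have : q * (q * Q) <= q * (Q / 16) by rewrite ler_wpM2l ?(ltW q_gt0) //; nra.
by nra.
Qed.

End TransferTime.

Theorem theorem2 (R : realType) (n : nat) (e : rel 'I_n) (s : 'I_n -> 'I_n)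
  (v : 'I_n) (d : nat) :
  simple_graph e -> connected_graph e -> graph_involution e s ->
  s v != v -> is_dist e v (s v) d ->
  (forall Q : R, (maxdeg e)%:R <= Q ->
     1 - 16 * Num.sqrt ((maxdeg e).+1%:R) / Num.sqrt Q
       < fidelity (hamil e Q v (s v)) v (s v)) /\
  (exists C Q0 : R, 0 < C /\
     forall Q : R, (maxdeg e)%:R <= Q ->
       exists t : R, 0 <= t /\
         1 - 16 * Num.sqrt ((maxdeg e).+1%:R) / Num.sqrt Q
           < transfer_prob (hamil e Q v (s v)) v (s v) t /\
         (Q0 <= Q -> t <= C * Q ^+ d.-1)).
Proof.
move=> graph_e _ inv_s sv dist_d; split=> [Q mQ|].
  have [t [t_ge0 _ p_gt]] :=
    transfer_time_sqrt_defect graph_e inv_s sv dist_d mQ.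
  apply: lt_le_trans p_gt _; apply: transfer_prob_le_fidelity => //.
  exact: tr_hamil graph_e.1.
exists (pi * 2 ^+ d.-1), 0; split; first by rewrite mulr_gt0 ?pi_gt0 ?exprn_gt0.
move=> Q mQ.
have [t [t_ge0 t_le p_gt]] :=
  transfer_time_sqrt_defect graph_e inv_s sv dist_d mQ.
by exists t; split=> //; split=> // _; rewrite -mulrA -exprMn.
Qed.
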